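(* Let $\theta$ be a rotation angle and $p\in[0,1]$ the error probability, and consider the two-qubit channel $$\mathcal{N}'=\mathcal{E}(p)\circ\mathcal{R}_{ZZ}(\theta),\qquad \mathcal{E}(p)=(1-p)\,\mathcal{I}+\frac p3\left(\mathcal{Z}_1+\mathcal{Z}_2+\mathcal{Z}_1\mathcal{Z}_2\right).$$ Then the channel extent and the augmented channel extent of $\mathcal{N}'$ satisfy $$\Xi(\mathcal{N}')\le1+\left(1-\tfrac23p\right)|\sin\theta|,\qquad \Xi^*(\mathcal{N}')\le1+(1-2p)|\sin\theta| .$$
   Context: $\mathcal{R}_{ZZ}(\theta)(\cdot)=R_{ZZ}(\theta)(\cdot)R_{ZZ}(\theta)^\dagger$ with $R_{ZZ}(\theta)=e^{-i\theta Z\otimes Z/2}$; $\mathcal{I}$ is the identity channel; $\mathcal{Z}_1(\cdot)=(Z\otimes I)(\cdot)(Z\otimes I)$, $\mathcal{Z}_2(\cdot)=(I\otimes Z)(\cdot)(I\otimes Z)$, and $\mathcal{Z}_1\mathcal{Z}_2$ is their composition. On $n$ qubits let $c_{2j-1}=Z^{\otimes(j-1)}\otimes X\otimes I^{\otimes(n-j)}$ and $c_{2j}=Z^{\otimes(j-1)}\otimes Y\otimes I^{\otimes(n-j)}$, $j=1,\dots,n$. The set $G_n$ of Gaussian unitaries consists of the $n$-qubit unitaries $V$ for which there is $R\in O(2n)$ with $Vc_jV^\dagger=\sum_kR_{j,k}c_k$ for all $j$; pure Gaussian states are the states $V|0\rangle^{\otimes n}$, $V\in G_n$. The unitary extent of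 an $n$-qubit unitary $U$ is $\xi(U)=\min\{\|c\|_1^2: U=\sum_{j}c_jK_j,\ K_j\in G_n,\ c_j\in\mathbb{C}\}$ (finite sums). For a convex-unitary channel $\mathcal{N}$ (a convex combination of unitary channels), the channel extent is $\Xi(\mathcal{N})=\min\{\sum_jp_j\xi(V_j):\mathcal{N}=\sum_jp_j\mathcal{V}_j\}$ over unitary channels $\mathcal{V}_j(\cdot)=V_j(\cdot)V_j^\dagger$ and probabilities $p_j\ge0$, $\sum_jp_j=1$. A convex-Gaussian channel is a CPTP map which maps convex mixtures of pure Gaussian states to convex mixtures of pure Gaussian states. The augmented channel extent is $\Xi^*(\mathcal{N})=\min\{\sum_jp_j\xi(V_j)+\sum_kq_k:\mathcal{N}=\sum_jp_j\mathcal{V}_j+\sum_kq_k\mathcal{G}_k\}$ over unitary channels $\mathcal{V}_j$, convex-Gaussian channels $\mathcal{G}_k$, and $p_j,q_k\ge0$ with $\sum_jp_j+\sum_kq_k=1$.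
   Formalization: The second inequality is stated only when p ≤ 1/2 or sin θ = 0; otherwise its right-hand side is below 1 while the augmented channel extent is always at least 1, so the printed bound fails (for example at p = 1, θ = π/2). *)

(* Defs.v *)
From mathcomp Require Import all_boot all_order all_algebra.
From mathcomp Require Import spectral complex mxtens.
From mathcomp Require Import boolp classical_sets reals ereal topology.
From mathcomp Require Import normedtype sequences trigo constructive_ereal.

Set Implicit Arguments.
Unset Strict Implicit.
Unset Printing Implicit Defensive.

Import Order.TTheory GRing.Theory Num.Theory.
Import numFieldNormedType.Exports.

Local Open Scope classical_set_scope.
Local Open Scope ring_scope.
Local Open Scope complex_scope.
Local Open Scope sesquilinear_scope.

(* The topology on complex matrices comes from R[i]^o, the same field R[i]
   seen as a normed space over itself; the series is the usual one and always
   converges. *)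
Definition expmx (R : realType) (d : nat) (A : 'M[R[i]]_d) : 'M[R[i]]_d :=
  limn (series (fun k => k`!%:R^-1 *: A ^+ k : 'M[R[i]^o]_d)).

Definition pauliX (R : realType) : 'M[R[i]]_2 :=
  \matrix_(a, b) (if a == b then 0 else 1).

Definition pauliY (R : realType) : 'M[R[i]]_2 :=
  \matrix_(a, b) (if a == b then 0 else if a == ord0 then - 'i else 'i).

Definition pauliZ (R : realType) : 'M[R[i]]_2 :=
  \matrix_(a, b) (if a == b then (if a == ord0 then 1 else -1) else 0).

Fixpoint tensor_rec (R : realType) (k : nat) (f : nat -> 'M[R[i]]_2) :
    'M[R[i]]_(2 ^ k.+1) :=
  match k with
  | 0 => f 0%N
  | k'.+1 => f 0%N *t tensor_rec k' (fun q => f q.+1)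
  end.

(* f 0 (x) f 1 (x) ... (x) f n.-1; qubits are numbered from 0, and qubit 0 is
   the leftmost factor. Ruling out n = 0 first avoids casts, since 2 ^ k.+2 is
   convertible to 2 * 2 ^ k.+1 but 2 ^ k.+1 is not to 2 * 2 ^ k. *)
Definition tensor (R : realType) (n : nat) :
    (nat -> 'M[R[i]]_2) -> 'M[R[i]]_(2 ^ n) :=
  match n with
  | 0 => fun=> 1%:M
  | k.+1 => tensor_rec k
  end.

(* Numbered from 0: index 2j carries X on qubit j and index 2j+1 carries Y on
   qubit j, with Z on the qubits to the left. *)
Definition majorana (R : realType) (n : nat) (m : 'I_n.*2) :
    'M[R[i]]_(2 ^ n) :=
  tensor n (fun q => if (q < m./2)%N then pauliZ R
                     else if q == m./2 then
                       (if odd m then pauliY R else pauliX R)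
                     else 1%:M).

Definition gaussian (R : realType) (n : nat) (V : 'M[R[i]]_(2 ^ n)) : Prop :=
  V \is unitarymx /\
  exists O : 'M[R]_(n.*2), O *m O^T = 1%:M /\
    forall j, V *m majorana R j *m V^t* =
              \sum_k (O j k)%:C *: majorana R k.

Definition ket0 (R : realType) (n : nat) : 'cV[R[i]]_(2 ^ n) :=
  \col_a ((a : nat) == 0%N)%:R.

Definition gaussian_state (R : realType) (n : nat)
    (psi : 'cV[R[i]]_(2 ^ n)) : Prop :=
  exists2 V, gaussian V & psi = V *m ket0 R n.

Definition prob_weights (R : realType) (m : nat) (p : 'I_m -> R) : Prop :=
  (forall j, 0 <= p j) /\ \sum_j p j = 1.

Definition gaussian_mixture (R : realType) (n : nat)
    (rho : 'M[R[i]]_(2 ^ n)) : Prop :=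
  exists (m : nat) (p : 'I_m -> R) (psi : 'I_m -> 'cV[R[i]]_(2 ^ n)),
    [/\ prob_weights p, forall j, gaussian_state (psi j) &
        rho = \sum_j (p j)%:C *: (psi j *m (psi j)^t*)].

Definition psdmx (R : realType) (d : nat) (A : 'M[R[i]]_d) : Prop :=
  forall v : 'cV[R[i]]_d, 0 <= (v^t* *m A *m v) 0 0.

(* id_k (x) Phi acts on a k x k array of d x d blocks by applying Phi to each
   block. *)
Definition cptp (R : realType) (d : nat)
    (Phi : 'M[R[i]]_d -> 'M[R[i]]_d) : Prop :=
  [/\ forall (a : R[i]) (A B : 'M[R[i]]_d),
        Phi (a *: A + B) = a *: Phi A + Phi B,
      forall (k : nat) (A : 'M[R[i]]_(\sum_(u < k) d)), psdmx A ->
        psdmx (\mxblock_(u < k, v < k) Phi (submxblock A u v)) &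
      forall A : 'M[R[i]]_d, \tr (Phi A) = \tr A].

Definition convex_gaussian_channel (R : realType) (n : nat)
    (Phi : 'M[R[i]]_(2 ^ n) -> 'M[R[i]]_(2 ^ n)) : Prop :=
  cptp Phi /\ forall rho, gaussian_mixture rho -> gaussian_mixture (Phi rho).

Definition unitary_channel (R : realType) (d : nat) (V : 'M[R[i]]_d) :
    'M[R[i]]_d -> 'M[R[i]]_d :=
  fun rho => V *m rho *m V^t*.

(* The three extents are infima in the extended reals, so that no junk value
   arises from an empty set of decompositions. *)
Definition unitary_extent (R : realType) (n : nat) (U : 'M[R[i]]_(2 ^ n)) :
    \bar R :=
  ereal_inf [set x | exists (m : nat) (c : 'I_m -> R[i])
                            (K : 'I_m -> 'M[R[i]]_(2 ^ n)),
    [/\ forall j, gaussian (K j), U = \sum_j c j *: K j &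
        x = ((\sum_j Normc.normc (c j)) ^+ 2)%:E]].

Definition channel_extent (R : realType) (n : nat)
    (N : 'M[R[i]]_(2 ^ n) -> 'M[R[i]]_(2 ^ n)) : \bar R :=
  ereal_inf [set x | exists (m : nat) (p : 'I_m -> R)
                            (V : 'I_m -> 'M[R[i]]_(2 ^ n)),
    [/\ prob_weights p, forall j, V j \is unitarymx,
        forall rho, N rho = \sum_j (p j)%:C *: unitary_channel (V j) rho &
        x = (\sum_j (p j)%:E * unitary_extent (V j))%E]].

Definition augmented_channel_extent (R : realType) (n : nat)
    (N : 'M[R[i]]_(2 ^ n) -> 'M[R[i]]_(2 ^ n)) : \bar R :=
  ereal_inf [set x | exists (m l : nat) (p : 'I_m -> R) (q : 'I_l -> R)
                            (V : 'I_m -> 'M[R[i]]_(2 ^ n))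
                            (G : 'I_l -> 'M[R[i]]_(2 ^ n) -> 'M[R[i]]_(2 ^ n)),
    [/\ [/\ forall j, 0 <= p j, forall k, 0 <= q k &
            \sum_j p j + \sum_k q k = 1],
        forall j, V j \is unitarymx,
        forall k, convex_gaussian_channel (G k),
        forall rho, N rho = \sum_j (p j)%:C *: unitary_channel (V j) rho
                            + \sum_k (q k)%:C *: G k rho &
        x = (\sum_j (p j)%:E * unitary_extent (V j)
             + \sum_k (q k)%:E)%E]].

Definition RZZ (R : realType) (theta : R) : 'M[R[i]]_(2 ^ 2) :=
  expmx ((- 'i * (theta / 2)%:C) *: (pauliZ R *t pauliZ R)).

Definition dephase1 (R : realType) (rho : 'M[R[i]]_(2 ^ 2)) :
    'M[R[i]]_(2 ^ 2) :=
  (pauliZ R *t 1%:M) *m rho *m (pauliZ R *t 1%:M).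

Definition dephase2 (R : realType) (rho : 'M[R[i]]_(2 ^ 2)) :
    'M[R[i]]_(2 ^ 2) :=
  (1%:M *t pauliZ R) *m rho *m (1%:M *t pauliZ R).

Definition noise (R : realType) (p : R) (rho : 'M[R[i]]_(2 ^ 2)) :
    'M[R[i]]_(2 ^ 2) :=
  (1 - p)%:C *: rho +
  (p / 3)%:C *: (dephase1 rho + dephase2 rho + dephase1 (dephase2 rho)).

(* Main.v *)
Require Import Defs.
From mathcomp Require Import all_boot all_order all_algebra.
From mathcomp Require Import spectral complex mxtens.
From mathcomp Require Import boolp classical_sets reals ereal topology.
From mathcomp Require Import normedtype sequences trigo constructive_ereal.
From mathcomp Require Import ring lra.

(* Write R for RZZ theta = cos(theta/2) I - i sin(theta/2) ZZ.  Both I and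
   ZZ are Gaussian, so R and ZZ R have extent at most
   (|cos(theta/2)| + |sin(theta/2)|)^2 = 1 + |sin theta|.  The interference
   terms of the channels of (Z (x) I) R and (I (x) Z) R cancel in their sum,
   which is therefore the sum of the channels of the Gaussian unitaries Z (x) I
   and I (x) Z.  Hence only the weights 1 - p of R and p/3 of ZZ R cost more
   than 1, which gives the first bound.

   For the second bound, a pure Gaussian state on two qubits has a definite
   parity: if V is Gaussian, then V^* ZZ V anticommutes with every Majorana
   operator, hence commutes with Z (x) I and I (x) Z, so |00> is one of its
   eigenvectors.  On a parity eigenvector R acts as a phase, so N' itself is
   a convex-Gaussian channel and its augmented extent is at most 1. *)

Set Implicit Arguments.
Unset Strict Implicit.
Unset Printing Implicit Defensive.

Import Order.TTheory GRing.Theory Num.Theory.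
Import numFieldNormedType.Exports.

Local Open Scope classical_set_scope.
Local Open Scope ring_scope.
Local Open Scope complex_scope.
Local Open Scope sesquilinear_scope.

(** * The exponential of an involution *)

Lemma cvg_real_complex (R : realType) (u : nat -> R) (l : R) :
  u @ \oo --> l -> (fun n => (u n)%:C : R[i]^o) @ \oo --> (l%:C : R[i]^o).
Proof.
(* A positive element of [R[i]] has zero imaginary part, so the radius is a real [e]. *)
move=> ul; apply/cvgrPdist_lt => -[e f]; rewrite ltcE /= => /andP[/eqP -> e0].
have /cvgrPdist_lt/(_ e e0) := ul.
apply: filterS => n ne; rewrite -rmorphB normc_def /= expr0n addr0 sqrtr_sqr.
by rewrite ltcR.
Qed.

(** A neighbourhood of [M] contains a product of neighbourhoods of the entries, and a filter is
    closed under the finite intersection over all index pairs. *)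
Lemma cvg_mx (T : topologicalType) (m n : nat) (I : Type) (F : set_system I)
    (FF : Filter F) (u : I -> 'M[T]_(m, n)) (M : 'M[T]_(m, n)) :
  (forall i j, (fun k => u k i j) @ F --> M i j) -> u @ F --> M.
Proof.
move=> uM A [P MP PA].
have : \forall k \near F, forall ij : 'I_m * 'I_n, P ij.1 ij.2 (u k ij.1 ij.2).
  by apply: filter_forall => -[i j]; apply: uM; apply: MP.
by apply: filterS => k Pk; apply: PA => i j; apply: (Pk (i, j)).
Qed.

(** Reduces the matrix limit to two real ones; [C] and [S] will be the partial sums of the cosine
    and sine series. *)
Lemma expmx_lim (R : realType) d (A B : 'M[R[i]]_d) (C S : nat -> R) (c s : R)
    (w : R[i]) :
  C @ \oo --> c -> S @ \oo --> s ->
  (forall n, series (fun k => k`!%:R^-1 *: A ^+ k) n =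
     (C n)%:C%:M + (w * (S n)%:C) *: B) ->
  expmx A = c%:C%:M + (w * s%:C) *: B.
Proof.
move=> Cc Ss E; rewrite /expmx.
have hM : hausdorff_space 'M[R[i]^o]_d :=
  @norm_hausdorff _ [the normedModType R[i]^o of 'M[R[i]^o]_d].
refine (cvg_lim hM _); apply: cvg_mx => i j.
have cvMl (f : nat -> R[i]^o) (l a : R[i]^o) :
    f @ \oo --> l -> (fun k => f k * a) @ \oo --> l * a.
  by move=> fl; apply: cvgM => //; exact: cvg_cst.
have -> : (fun k => series (fun k => k`!%:R^-1 *: A ^+ k : 'M[R[i]^o]_d) k i j)
  = (fun k => ((C k)%:C : R[i]^o) * (i == j)%:R) \+
    (fun k => ((S k)%:C : R[i]^o) * (w * B i j)).
  apply/funext => k /=; have /matrixP/(_ i j) -> := E k.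
  by rewrite !mxE mulr_natr mulrCA mulrA.
have -> : (c%:C%:M + (w * s%:C) *: B) i j =
    c%:C * (i == j)%:R + s%:C * (w * B i j).
  by rewrite !mxE mulr_natr mulrCA mulrA.
apply: (@cvgD R[i]^o R[i]^o); apply: cvMl; exact: cvg_real_complex.
Qed.

Lemma exprZmx (K : comPzRingType) d (a : K) (B : 'M[K]_d) k :
  (a *: B) ^+ k = a ^+ k *: B ^+ k.
Proof.
elim: k => [|k IHk]; first by rewrite !expr0 scale1r.
by rewrite !exprS IHk -!mulmxE -scalemxAl -scalemxAr scalerA.
Qed.

(** Powers of [B] depend only on the parity of the exponent, and [w ^+ k] is a sign times [1] or
    [w]. Even terms thus form the cosine series and odd terms [w] times the sine series. *)
Lemma expmx_involution (R : realType) d (w : R[i]) (t : R) (B : 'M[R[i]]_d) :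
  w ^+ 2 = -1 -> B *m B = 1%:M ->
  expmx ((w * t%:C) *: B) = (cos t)%:C%:M + (w * (sin t)%:C) *: B.
Proof.
move=> w2 B2.
have cosC : series (cos_coeff t) @ \oo --> cos t.
  by rewrite trigo.cos.unlock; exact: is_cvg_series_cos_coeff.
have sinC : series (sin_coeff t) @ \oo --> sin t.
  by rewrite trigo.sin.unlock; exact: is_cvg_series_sin_coeff.
apply: (expmx_lim cosC sinC) => n.
have wX k : w ^+ k = (-1) ^+ k./2 * w ^+ odd k.
  by rewrite -{1}(odd_double_half k) exprD mulrC -mul2n exprM w2.
have BX k : B ^+ k = B ^+ odd k.
  rewrite -{1}(odd_double_half k) exprD -mul2n exprM.
  by rewrite (_ : B ^+ 2 = 1) ?expr1n ?mulr1// expr2 -mulmxE B2.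
rewrite /series /= !rmorph_sum /= mulr_sumr scaler_suml.
rewrite -big_split /=; apply: eq_bigr => k _.
rewrite exprZmx BX exprMn wX /cos_coeff /sin_coeff -[_%:M]scalemx1 /=.
have [ok|ok] := boolP (odd k); rewrite ?ok ?(negbTE ok) /=.
  rewrite mulr0n mulr1n !mul0r scale0r add0r mul1r !expr1 scalerA; congr (_ *: _).
  (* [sin_coeff] takes its sign from [k.-1./2], which equals [k./2] only because [k] is odd. *)
  rewrite (_ : k.-1./2 = k./2); last first.
    by case: k ok => // k /= /negbTE ok; rewrite uphalf_half ok.
  by rewrite !rmorphM /= fmorphV rmorph_nat !rmorphXn rmorphN1; ring.
rewrite mulr0n mulr1n !mul0r mulr0 scale0r addr0 mul1r !expr0 mulr1 scalerA.
congr (_ *: _).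
by rewrite -exprnP !rmorphM /= fmorphV rmorph_nat !rmorphXn rmorphN1; ring.
Qed.

(** * Two-qubit Gaussian unitaries and states *)

Section TensorProduct.
Variables (m n p q : nat).

Lemma tensmx_adj (K : numClosedFieldType) (A : 'M[K]_(m, n)) (B : 'M[K]_(p, q)) :
  (A *t B)^t* = A^t* *t B^t*.
Proof. by rewrite trmx_tens map_mxT. Qed.

Lemma tensmxNl (K : pzRingType) (A : 'M[K]_(m, n)) (B : 'M[K]_(p, q)) :
  (- A) *t B = - (A *t B).
Proof. by apply/matrixP=> i j; rewrite !mxE mulNr. Qed.

Lemma tensmxNr (K : pzRingType) (A : 'M[K]_(m, n)) (B : 'M[K]_(p, q)) :
  A *t (- B) = - (A *t B).
Proof. by apply/matrixP=> i j; rewrite !mxE mulrN. Qed.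

Lemma tensmxZl (K : pzRingType) a (A : 'M[K]_(m, n)) (B : 'M[K]_(p, q)) :
  (a *: A) *t B = a *: (A *t B).
Proof. by apply/matrixP=> i j; rewrite !mxE mulrA. Qed.

Lemma tensmxZr (K : comPzRingType) a (A : 'M[K]_(m, n)) (B : 'M[K]_(p, q)) :
  A *t (a *: B) = a *: (A *t B).
Proof. by apply/matrixP=> i j; rewrite !mxE mulrCA. Qed.

Lemma tensmx11 (K : pzRingType) : (1%:M : 'M[K]_m) *t (1%:M : 'M[K]_n) = 1%:M.
Proof.
apply/matrixP => i j.
by rewrite !mxE -natrM mulnb -(inj_eq (can_inj (@mxtens_unindexK m n))).
Qed.

End TensorProduct.

(** * Pauli operators and the Majorana operators on two qubits *)

Section Pauli.
Variable R : realType.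
Local Notation C := R[i].
Local Notation X := (pauliX R).
Local Notation Y := (pauliY R).
Local Notation Z := (pauliZ R).

Ltac mx2 := apply/matrixP; do 2![case=> -[|[|//]] ?];
  rewrite !mxE ?big_ord_recl ?big_ord0 ?mxE /=;
  apply/eqP; rewrite eq_complex /=; simpc.

Lemma pauliZZ : Z *m Z = 1%:M. Proof. by mx2. Qed.

Lemma pauliXY : X *m Y = 'i *: Z. Proof. by mx2. Qed.

Lemma pauliZX : Z *m X = - (X *m Z). Proof. by mx2. Qed.

Lemma pauliZY : Z *m Y = - (Y *m Z). Proof. by mx2. Qed.

Lemma pauliZ_adj : Z^t* = Z. Proof. by mx2. Qed.

Definition ZI : 'M[C]_(2 ^ 2) := Z *t 1%:M.
Definition IZ : 'M[C]_(2 ^ 2) := 1%:M *t Z.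
Definition ZZ : 'M[C]_(2 ^ 2) := Z *t Z.

Lemma ZI_IZ : ZI *m IZ = ZZ.
Proof. by rewrite tensmx_mul mulmx1 mul1mx. Qed.

Lemma ZI_sqr : ZI *m ZI = 1%:M.
Proof. by rewrite tensmx_mul mulmx1 pauliZZ tensmx11. Qed.

Lemma IZ_sqr : IZ *m IZ = 1%:M.
Proof. by rewrite tensmx_mul mulmx1 pauliZZ tensmx11. Qed.

Lemma ZI_adj : ZI^t* = ZI.
Proof. by rewrite tensmx_adj pauliZ_adj trmx1 map_mx1. Qed.

Lemma IZ_adj : IZ^t* = IZ.
Proof. by rewrite tensmx_adj pauliZ_adj trmx1 map_mx1. Qed.

Lemma ZI_IZ_comm : ZI *m IZ = IZ *m ZI.
Proof. by rewrite !tensmx_mul !mulmx1 !mul1mx. Qed.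

(** The type ['M_(2*2)] exposes the tensor shape hidden in [2 ^ 2], so that products can be computed
    factor by factor. *)
Lemma majorana2E (j : 'I_2.*2) : @majorana R 2 j =
  (if (j < 2)%N then (if odd j then Y else X) *t 1%:M
   else Z *t (if odd j then Y else X)) :> 'M_(2*2).
Proof. by case: j => -[|[|[|[|//]]]]. Qed.

(** [Z] anticommutes with the [X] or [Y] that indices 0 and 1 carry on qubit 0, and commutes with
    the [Z] that indices 2 and 3 carry there. *)
Lemma ZI_majorana (j : 'I_2.*2) :
  ZI *m majorana R j =
  (-1) ^+ (j < 2)%N *: (majorana R j *m ZI).
Proof.
rewrite majorana2E.
by case: j => -[|[|[|[|//]]]] /= _; rewrite !tensmx_mul ?mul1mx ?mulmx1
  ?pauliZX ?pauliZY ?tensmxNl ?tensmxNr ?scaleN1r ?scale1r.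
Qed.

Lemma IZ_majorana (j : 'I_2.*2) :
  IZ *m majorana R j =
  (-1) ^+ (2 <= j)%N *: (majorana R j *m IZ).
Proof.
rewrite majorana2E.
by case: j => -[|[|[|[|//]]]] /= _; rewrite !tensmx_mul ?mul1mx ?mulmx1
  ?pauliZX ?pauliZY ?tensmxNl ?tensmxNr ?scaleN1r ?scale1r.
Qed.

Local Notation mj k := (@majorana R 2 (@Ordinal 2.*2 k isT)).

(** With [majorana23], this makes [ZI] and [IZ] quadratic in the Majorana operators, the form that
    [commute_majorana2] takes. *)
Lemma majorana01 : mj 0 *m mj 1 = 'i *: ZI.
Proof. by rewrite !majorana2E /= tensmx_mul mulmx1 pauliXY tensmxZl. Qed.

Lemma majorana23 : mj 2 *m mj 3 = 'i *: IZ.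
Proof. by rewrite !majorana2E /= tensmx_mul pauliZZ pauliXY tensmxZr. Qed.

(** Each factor is twice the projector onto the state 0 of one qubit, whence the 4. *)
Lemma ket0_proj : (1%:M + ZI) *m (1%:M + IZ) = 4 *: (ket0 R 2 *m (ket0 R 2)^T).
Proof.
have -> : 1%:M + ZI = (1%:M + Z) *t 1%:M.
  by rewrite -tensmx11; apply/matrixP => i j; rewrite !mxE -mulrDl.
have -> : 1%:M + IZ = 1%:M *t (1%:M + Z).
  by rewrite -tensmx11; apply/matrixP => i j; rewrite !mxE -mulrDr.
rewrite tensmx_mul mul1mx mulmx1.
apply/matrixP; do 2![case=> -[|[|[|[|//]]]] ?];
rewrite !mxE ?big_ord_recl ?big_ord0 ?mxE /=; ring.
Qed.

(** * Gaussian unitaries: sign flips and products *)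

Lemma gaussian_sign n (V : 'M[C]_(2 ^ n)) (e : 'I_n.*2 -> bool) :
  V \is unitarymx ->
  (forall j, V *m majorana R j = (-1) ^+ e j *: (majorana R j *m V)) ->
  gaussian V.
Proof.
(* Conjugation by [V] only flips signs of Majorana operators, so the orthogonal matrix is diagonal
   with entries 1 and -1. *)
move=> Vu Vc; split=> //; exists (diag_mx (\row_j (-1) ^+ e j)); split.
  rewrite tr_diag_mx mulmx_diag -diag_const_mx; congr diag_mx.
  by apply/rowP => j; rewrite !mxE -expr2 sqrr_sign.
move=> j; rewrite Vc -scalemxAl -mulmxA (unitarymxP _) // mulmx1.
rewrite (bigD1 j) //= big1 ?addr0 => [|k kj]; rewrite !mxE.
  by rewrite eqxx mulr1n rmorphXn rmorphN1.
by rewrite eq_sym (negbTE kj) mulr0n scale0r.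
Qed.

Lemma gaussian_mul n (U V : 'M[C]_(2 ^ n)) :
  gaussian U -> gaussian V -> gaussian (U *m V).
Proof.
move=> [Uu [P [PP UP]]] [Vu [Q [QQ VQ]]]; split; first exact: mul_unitarymx.
(* The order is reversed: the inner conjugation by [V] expands row [j] through [Q], and then [U]
   acts on each resulting operator through [P]. *)
exists (Q *m P); split.
  by rewrite trmx_mul mulmxA -(mulmxA Q) PP mulmx1.
move=> j; have -> : U *m V *m majorana R j *m (U *m V)^t* =
    U *m (V *m majorana R j *m V^t*) *m U^t*.
  by rewrite trmx_mul map_mxM !mulmxA.
rewrite VQ mulmx_sumr mulmx_suml.
transitivity (\sum_k \sum_l ((Q j k)%:C * (P k l)%:C) *: majorana R l).
  apply: eq_bigr => k _; rewrite -scalemxAr -scalemxAl UP scaler_sumr.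
  by apply: eq_bigr => l _; rewrite scalerA.
rewrite exchange_big /=; apply: eq_bigr => l _; rewrite -scaler_suml mxE rmorph_sum.
by congr (_ *: _); apply: eq_bigr => k _; rewrite rmorphM.
Qed.

Lemma gaussian1 n : gaussian (1%:M : 'M[C]_(2 ^ n)).
Proof.
apply: (@gaussian_sign _ _ (fun=> false)) => [|j].
  by apply/unitarymxP; rewrite mul1mx trmx1 map_mx1.
by rewrite mul1mx mulmx1 scale1r.
Qed.

Lemma gaussian_ZI : gaussian ZI.
Proof.
apply: gaussian_sign ZI_majorana.
by apply/unitarymxP; rewrite ZI_adj ZI_sqr.
Qed.

Lemma gaussian_IZ : gaussian IZ.
Proof.
apply: gaussian_sign IZ_majorana.
by apply/unitarymxP; rewrite IZ_adj IZ_sqr.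
Qed.

Lemma gaussian_ZZ : gaussian ZZ.
Proof. by rewrite -ZI_IZ; apply: gaussian_mul gaussian_ZI gaussian_IZ. Qed.

Lemma ZZ_sqr : ZZ *m ZZ = 1%:M.
Proof. by rewrite tensmx_mul pauliZZ tensmx11. Qed.

Lemma ZZ_adj : ZZ^t* = ZZ.
Proof. by rewrite tensmx_adj pauliZ_adj. Qed.

Lemma ZZ_majorana (j : 'I_2.*2) : ZZ *m majorana R j = - (majorana R j *m ZZ).
Proof.
rewrite -ZI_IZ -mulmxA IZ_majorana -scalemxAr [ZI *m (_ *m _)]mulmxA.
rewrite ZI_majorana -scalemxAl scalerA -signr_addb -!mulmxA.
(* Exactly one of [j < 2] and [2 <= j] holds, so the two signs multiply to -1. *)
by rewrite leqNgt -ltnS addNb ltnS addbb expr1 scaleN1r.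
Qed.

(** * Parity of two-qubit Gaussian states *)

Lemma ket0_ZI : ZI *m ket0 R 2 = ket0 R 2.
Proof.
apply/matrixP; case=> -[|[|[|[|//]]]] ? j;
rewrite !mxE ?big_ord_recl ?big_ord0 ?mxE /=; ring.
Qed.

Lemma ket0_IZ : IZ *m ket0 R 2 = ket0 R 2.
Proof.
apply/matrixP; case=> -[|[|[|[|//]]]] ? j;
rewrite !mxE ?big_ord_recl ?big_ord0 ?mxE /=; ring.
Qed.

(** On such a [v] the operator of [ket0_proj] acts as 4, yet its range is spanned by [ket0]; the
    coefficient is the overlap of [v] with [ket0]. *)
Lemma ket0_unique (v : 'cV[C]_(2 ^ 2)) :
  ZI *m v = v -> IZ *m v = v -> exists l : C, v = l *: ket0 R 2.
Proof.
move=> v1 v2; exists (((ket0 R 2)^T *m v) 0 0).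
have : (1%:M + ZI) *m (1%:M + IZ) *m v = 4 *: v.
  by rewrite -mulmxA 2!mulmxDl !mul1mx v2 mulmxDr v1 -!mulr2n -mulrnA scaler_nat.
rewrite ket0_proj -scalemxAl => /(scalerI _) vE.
rewrite -{1}vE; last by rewrite pnatr_eq0.
by rewrite -mulmxA [X in _ *m X]mx11_scalar mul_mx_scalar.
Qed.

(** Moving [P] past two Majorana operators produces two minus signs, which cancel. *)
Lemma commute_majorana2 (P : 'M[C]_(2 ^ 2)) (i j : 'I_2.*2) (A : 'M[C]_(2 ^ 2)) :
  (forall k, P *m majorana R k = - (majorana R k *m P)) ->
  majorana R i *m majorana R j = 'i *: A -> P *m A = A *m P.
Proof.
move=> Pc cA; have i0 : 'i%C != 0 :> C by rewrite eq_complex /= oner_eq0 andbF.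
apply: (scalerI i0); rewrite scalemxAr scalemxAl -cA.
by rewrite mulmxA Pc mulNmx -mulmxA Pc mulmxN opprK mulmxA.
Qed.

Lemma gaussian_parity (V : 'M[C]_(2 ^ 2)) : gaussian V ->
  exists2 l : C, l ^+ 2 = 1 & ZZ *m (V *m ket0 R 2) = l *: (V *m ket0 R 2).
Proof.
move=> [/unitarymxP Vu [O [OO VO]]].
have VV : V^t* *m V = 1%:M by apply: mulmx1C.
(* [P] is the parity operator pulled back through [V]. Conjugation by [V] turns a Majorana operator
   into a linear combination [S] of Majorana operators, with which [ZZ] still anticommutes. *)
pose P := V^t* *m ZZ *m V.
have Pc j : P *m majorana R j = - (majorana R j *m P).
  pose S := \sum_k (O j k)%:C *: majorana R k.
  have WS : ZZ *m S = - (S *m ZZ).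
    rewrite mulmx_sumr mulmx_suml -sumrN; apply: eq_bigr => k _.
    by rewrite -scalemxAr ZZ_majorana scalerN scalemxAl.
  have VS : V *m majorana R j = S *m V by rewrite /S -VO -!mulmxA VV mulmx1.
  have SV : majorana R j *m V^t* = V^t* *m S.
    by rewrite /S -VO !mulmxA VV mul1mx.
  rewrite /P -!mulmxA VS !mulmxA SV -(mulmxA _ ZZ S) WS mulmxN mulNmx.
  by rewrite !mulmxA.
have [l Pl] : exists l : C, P *m ket0 R 2 = l *: ket0 R 2.
  apply: ket0_unique; rewrite mulmxA.
    by rewrite -(commute_majorana2 Pc majorana01) -mulmxA ket0_ZI.
  by rewrite -(commute_majorana2 Pc majorana23) -mulmxA ket0_IZ.
exists l.
  (* Applied to [ket0], this yields [l ^+ 2 = 1], read off at the entry where [ket0] equals 1. *)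
  have : P *m P = 1%:M.
    by rewrite /P !mulmxA -(mulmxA _ V) Vu mulmx1 -(mulmxA _ ZZ ZZ) ZZ_sqr mulmx1.
  move=> /(congr1 (mulmx^~ (ket0 R 2))); rewrite -mulmxA Pl -scalemxAr Pl.
  rewrite scalerA mul1mx => /matrixP/(_ 0 0); rewrite !mxE /= mulr1.
  by rewrite expr2.
have -> : ZZ *m (V *m ket0 R 2) = V *m (P *m ket0 R 2).
  by rewrite /P !mulmxA Vu mul1mx.
by rewrite Pl scalemxAr.
Qed.

End Pauli.

(** * Mixtures of unitary channels *)

Lemma map_mxdiag_rmorph (K L : pzRingType) (f : {rmorphism K -> L}) k (p_ : 'I_k -> nat)
    (B : forall u, 'M[K]_(p_ u)) :
  map_mx f (\mxdiag_(u < k) B u) = \mxdiag_(u < k) map_mx f (B u).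
Proof.
apply/matrixP => i j; rewrite !mxE.
case: eqVneq => ij; last by rewrite !mxE rmorph0.
by rewrite -(map_mx0 f) -map_conform_mx mxE.
Qed.

Lemma psdmx_conj (R : realType) d (A : 'M[R[i]]_d) (D : 'M[R[i]]_d) :
  psdmx A -> psdmx (D *m A *m D^t*).
Proof.
move=> A_ge0 v; have := A_ge0 (D^t* *m v).
by rewrite trmx_mul map_mxM trmxCK !mulmxA.
Qed.

Lemma psdmx_sum (R : realType) d m (w : 'I_m -> R) (A : 'I_m -> 'M[R[i]]_d) :
  (forall t, 0 <= w t) -> (forall t, psdmx (A t)) ->
  psdmx (\sum_t (w t)%:C *: A t).
Proof.
move=> w0 A0 v; rewrite mulmx_sumr mulmx_suml summxE sumr_ge0 // => t _.
by rewrite -scalemxAr -scalemxAl mxE mulr_ge0 ?ler0c //; apply: A0.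
Qed.

(** For complete positivity, applying the channel blockwise amounts to a mixture of conjugations by
    block-diagonal matrices with [V t] repeated. The trace is preserved by cyclicity. *)
Lemma cptp_mixture (R : realType) d m (w : 'I_m -> R) (V : 'I_m -> 'M[R[i]]_d) :
  prob_weights w -> (forall t, V t \is unitarymx) ->
  cptp (fun rho => \sum_t (w t)%:C *: unitary_channel (V t) rho).
Proof.
move=> [w0 w1] Vu; split=> [a A B|k A A0|A].
- rewrite scaler_sumr -big_split; apply: eq_bigr => t _ /=.
  rewrite /unitary_channel mulmxDr mulmxDl -scalemxAr -scalemxAl scalerDr.
  by rewrite !scalerA mulrC.
- have -> : \mxblock_(u < k, v < k)
      (\sum_t (w t)%:C *: unitary_channel (V t) (submxblock A u v)) =
    \sum_t (w t)%:C *: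
      (\mxdiag_(u < k) V t *m A *m (\mxdiag_(u < k) V t)^t*).
    rewrite mxblock_sum; apply: eq_bigr => t _.
    rewrite tr_mxdiag map_mxdiag_rmorph -[A in RHS]submxblockK.
    rewrite mul_mxdiag_mxblock mul_mxblock_mxdiag.
    by apply/matrixP => i j; rewrite !mxE.
  by apply: psdmx_sum w0 _ => t; apply: psdmx_conj A0.
- rewrite raddf_sum /= (eq_bigr (fun t => (w t)%:C * \tr A)).
    by rewrite -mulr_suml -rmorph_sum w1 mul1r.
  move=> t _; rewrite linearZ /= /unitary_channel mxtrace_mulC mulmxA.
  by have /unitarymxP/mulmx1C -> := Vu t; rewrite mul1mx.
Qed.

(** Allows any finite index type, in particular the pairs that arise when a mixture of channels acts
    on a mixture of states. *)
Lemma gaussian_mixture_fin (R : realType) n (T : finType) (p : T -> R)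
    (psi : T -> 'cV[R[i]]_(2 ^ n)) :
  (forall t, 0 <= p t) -> \sum_t p t = 1 -> (forall t, gaussian_state (psi t)) ->
  gaussian_mixture (\sum_t (p t)%:C *: (psi t *m (psi t)^t*)).
Proof.
move=> p0 p1 psiG; exists #|T|, (p \o enum_val), (psi \o enum_val); split=> //.
- split=> [j|]; first exact: p0.
  by rewrite -p1 [RHS](reindex _ (onW_bij _ (enum_val_bij T))).
- by move=> j; apply: psiG.
- by rewrite (reindex _ (onW_bij _ (enum_val_bij T))).
Qed.

(** The hypothesis compares projectors rather than vectors, so [V t] may multiply a Gaussian state
    by a phase without being Gaussian itself. *)
Lemma convex_gaussian_mixture (R : realType) n m (w : 'I_m -> R)
    (V : 'I_m -> 'M[R[i]]_(2 ^ n)) :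
  prob_weights w -> (forall t, V t \is unitarymx) ->
  (forall t psi, gaussian_state psi -> exists2 phi, gaussian_state phi &
     unitary_channel (V t) (psi *m psi^t*) = phi *m phi^t*) ->
  convex_gaussian_channel
    (fun rho => \sum_t (w t)%:C *: unitary_channel (V t) rho).
Proof.
move=> wP Vu VG; split; first exact: cptp_mixture.
move=> _ [k [p [psi [[p0 p1] psiG ->]]]].
have /choice[phi phiP] : forall tj : 'I_m * 'I_k, exists phi, gaussian_state phi /\
    unitary_channel (V tj.1) (psi tj.2 *m (psi tj.2)^t*) = phi *m phi^t*.
  by move=> [t j] /=; have [phi] := VG t _ (psiG j); exists phi.
have -> : \sum_t (w t)%:C *: unitary_channel (V t)
      (\sum_j (p j)%:C *: (psi j *m (psi j)^t*)) =
    \sum_tj (w tj.1 * p tj.2)%:C *: (phi tj *m (phi tj)^t*).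
  transitivity (\sum_t \sum_j (w t * p j)%:C *: (phi (t, j) *m (phi (t, j))^t*)).
    apply: eq_bigr => t _; rewrite /unitary_channel mulmx_sumr mulmx_suml scaler_sumr.
    apply: eq_bigr => j _; rewrite -scalemxAr -scalemxAl scalerA -rmorphM.
    by rewrite -(phiP (t, j)).2.
  by rewrite pair_bigA; apply: eq_bigr => -[t j].
case: wP => w0 w1.
apply: gaussian_mixture_fin => [tj||tj]; first by rewrite mulr_ge0.
- rewrite -(pair_bigA _ (fun t j => w t * p j)) /=.
  by under eq_bigr do rewrite -mulr_sumr p1 mulr1.
- exact: (phiP tj).1.
Qed.

(** * Upper bounds on the unitary extent *)

Lemma unitary_extent_pair (R : realType) n (K0 K1 : 'M[R[i]]_(2 ^ n)) (c0 c1 : R[i]) :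
  gaussian K0 -> gaussian K1 ->
  (unitary_extent (c0 *: K0 + c1 *: K1) <=
    ((Normc.normc c0 + Normc.normc c1) ^+ 2)%:E)%E.
Proof.
move=> G0 G1; apply: ereal_inf_lbound.
exists 2%N, (fun j => if j == ord0 then c0 else c1),
  (fun j => if j == ord0 then K0 else K1); split.
- by move=> j; case: ifP.
- by rewrite !big_ord_recl big_ord0 addr0.
- by rewrite !big_ord_recl big_ord0 addr0.
Qed.

Lemma unitary_extent_gaussian (R : realType) n (K : 'M[R[i]]_(2 ^ n)) :
  gaussian K -> (unitary_extent K <= 1%:E)%E.
Proof.
move=> GK; have := unitary_extent_pair 1 0 GK GK.
by rewrite scale1r scale0r addr0 Normc.normc1 Normc.normc0 addr0 expr1n.
Qed.

(** * The noisy ZZ rotation *)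

Section Extent.
Variable R : realType.
Implicit Types (theta p : R) (rho : 'M[R[i]]_(2 ^ 2)).
Local Notation ZI := (ZI R).
Local Notation IZ := (IZ R).
Local Notation ZZ := (ZZ R).
Local Notation cosC theta := ((cos (theta / 2))%:C : R[i]).
Local Notation sinC theta := (- 'i%C * (sin (theta / 2))%:C : R[i]).

Lemma RZZE theta : RZZ theta = cosC theta *: 1%:M + sinC theta *: ZZ.
Proof.
rewrite scalemx1; apply: expmx_involution; last exact: ZZ_sqr.
by rewrite sqrrN sqr_i.
Qed.

Lemma conj_cosC theta : Num.conj (cosC theta) = cosC theta.
Proof. by apply/eqP; rewrite eq_complex /= oppr0 !eqxx. Qed.

Lemma conj_sinC theta : Num.conj (sinC theta) = - sinC theta.
Proof. by apply/eqP; rewrite eq_complex /=; simpc. Qed.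

Lemma RZZ_adj theta : (RZZ theta)^t* = cosC theta *: 1%:M - sinC theta *: ZZ.
Proof.
rewrite RZZE linearD !linearZ /= map_mxD !map_mxZ trmx1 map_mx1 -/(ZZ^t*) ZZ_adj.
by rewrite /= conj_cosC conj_sinC scaleNr scalerN.
Qed.

(** The minus sign appears because [sinC] includes the factor [- 'i]; this is the normalisation used
    in every later computation with [RZZ]. *)
Lemma cosC_sinC theta : cosC theta ^+ 2 - sinC theta ^+ 2 = 1.
Proof.
by rewrite exprMn sqrrN sqr_i mulN1r opprK -!rmorphXn -rmorphD cos2Dsin2.
Qed.

Lemma unitary_channel_mul d (U V : 'M[R[i]]_d) A :
  unitary_channel (U *m V) A = unitary_channel U (unitary_channel V A).
Proof. by rewrite /unitary_channel trmx_mul map_mxM !mulmxA. Qed.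

Lemma unitary_channelD d (U : 'M[R[i]]_d) A B :
  unitary_channel U (A + B) = unitary_channel U A + unitary_channel U B.
Proof. by rewrite /unitary_channel mulmxDr mulmxDl. Qed.

(** Multiplying by the involution [ZZ] swaps the two coefficients, so the bound on the extent is the
    same as for [RZZ]. *)
Lemma ZZ_RZZ theta : ZZ *m RZZ theta = sinC theta *: 1%:M + cosC theta *: ZZ.
Proof.
by rewrite RZZE mulmxDr -!scalemxAr mulmx1 ZZ_sqr addrC.
Qed.

Lemma RZZ_unitary theta : RZZ theta \is unitarymx.
Proof.
apply/unitarymxP; rewrite RZZ_adj RZZE; have := cosC_sinC theta.
move: (cosC theta) (sinC theta) => c s cs1.
rewrite mulmxBr !mulmxDl -!scalemxAr -!scalemxAl !mul1mx !mulmx1 ZZ_sqr.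
transitivity ((c ^+ 2 - s ^+ 2) *: 1%:M : 'M[R[i]]_(2 ^ 2)); last first.
  by rewrite cs1 scale1r.
move: (1%:M) ZZ => A B; apply/matrixP => i j; rewrite !mxE; ring.
Qed.

(** The cross terms of the first channel form a multiple of the commutator of [ZZ] and [rho].
    Conjugation by [ZZ] reverses its sign, so it cancels in the sum. *)
Lemma RZZ_channel_parity theta rho :
  unitary_channel (RZZ theta) rho + unitary_channel (ZZ *m RZZ theta) rho =
  rho + unitary_channel ZZ rho.
Proof.
rewrite [in X in _ + X]unitary_channel_mul.
rewrite /unitary_channel RZZ_adj ZZ_adj RZZE; have := cosC_sinC theta.
move: (cosC theta) (sinC theta) => c s cs1.
transitivity ((c ^+ 2 - s ^+ 2) *: (rho + ZZ *m rho *m ZZ)); last first.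
  by rewrite cs1 scale1r.
have E : (c *: 1%:M + s *: ZZ) *m rho *m (c *: 1%:M - s *: ZZ) =
    c ^+ 2 *: rho - s ^+ 2 *: (ZZ *m rho *m ZZ)
    + (c * s) *: (ZZ *m rho - rho *m ZZ).
  rewrite mulmxBr !mulmxDl -!scalemxAr -!scalemxAl !mul1mx !mulmx1.
  move: (ZZ *m rho) (rho *m ZZ) (ZZ *m rho *m ZZ) => A B D.
  apply/matrixP => i j; rewrite !mxE; ring.
rewrite E !(mulmxDr, mulmxDl, mulmxN, mulNmx) -!scalemxAr -!scalemxAl.
rewrite !(mulmxDr, mulmxDl, mulmxN, mulNmx).
rewrite !mulmxA ZZ_sqr -!(mulmxA _ ZZ ZZ) ZZ_sqr !mul1mx !mulmx1.
move: (ZZ *m rho) (rho *m ZZ) (ZZ *m rho *m ZZ) => A B D.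
apply/matrixP => i j; rewrite !mxE; ring.
Qed.

Lemma RZZ_eigen theta (psi : 'cV[R[i]]_(2 ^ 2)) (l : R[i]) :
  l ^+ 2 = 1 -> ZZ *m psi = l *: psi ->
  unitary_channel (RZZ theta) (psi *m psi^t*) = psi *m psi^t*.
Proof.
move=> l2 ZZpsi.
have -> : unitary_channel (RZZ theta) (psi *m psi^t*) =
    (RZZ theta *m psi) *m (RZZ theta *m psi)^t*.
  by rewrite /unitary_channel trmx_mul map_mxM !mulmxA.
have -> : RZZ theta *m psi = (cosC theta + sinC theta * l) *: psi.
  by rewrite RZZE mulmxDl -!scalemxAl mul1mx ZZpsi scalerA scalerDl.
rewrite linearZ /= map_mxZ -scalemxAl -scalemxAr scalerA.
rewrite (_ : _ * _ = 1) ?scale1r //.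
rewrite rmorphD rmorphM /= conj_cosC conj_sinC.
have := cosC_sinC theta; move: (cosC theta) (sinC theta) => c s cs1.
(* Since [l] is 1 or -1, it is its own conjugate, and the squared modulus of the phase is
   [c ^+ 2 - s ^+ 2]. *)
have /orP[/eqP ->|/eqP ->] : (l == 1) || (l == -1) by rewrite -sqrf_eq1 l2.
  by rewrite rmorph1 !mulr1 -cs1; ring.
by rewrite rmorphN1 !mulrN1 -cs1; ring.
Qed.

Lemma normc_cosC theta : Normc.normc (cosC theta) = `|cos (theta / 2)|.
Proof. by rewrite /= expr0n addr0 sqrtr_sqr. Qed.

Lemma normc_sinC theta : Normc.normc (sinC theta) = `|sin (theta / 2)|.
Proof. by rewrite /=; simpc; rewrite expr0n add0r sqrrN sqrtr_sqr. Qed.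

(** The cross term of the square is the absolute value of [sin theta] by the double-angle
    formula. *)
Lemma sqr_norm_cosDsin theta :
  (`|cos (theta / 2)| + `|sin (theta / 2)|) ^+ 2 = 1 + `|sin theta|.
Proof.
rewrite sqrrD !real_normK ?num_real // addrAC cos2Dsin2 -normrM -normrMn.
by rewrite -sin_mulr2n -(mulr_natr (theta / 2)) divfK ?pnatr_eq0.
Qed.

Lemma unitary_extent_RZZ theta :
  (unitary_extent (RZZ theta) <= (1 + `|sin theta|)%:E)%E.
Proof.
rewrite -sqr_norm_cosDsin -normc_cosC -normc_sinC RZZE.
exact: unitary_extent_pair (gaussian1 R 2) (gaussian_ZZ R).
Qed.

Lemma unitary_extent_ZZ_RZZ theta :
  (unitary_extent (ZZ *m RZZ theta) <= (1 + `|sin theta|)%:E)%E.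
Proof.
rewrite -sqr_norm_cosDsin addrC -normc_cosC -normc_sinC ZZ_RZZ.
exact: unitary_extent_pair (gaussian1 R 2) (gaussian_ZZ R).
Qed.

(** * Two decompositions of the noisy rotation *)

Definition noise_weight p (t : 'I_4) : R := if t == ord0 then 1 - p else p / 3.
Definition noise_kraus (t : 'I_4) : 'M[R[i]]_(2 ^ 2) :=
  nth 1%:M [:: 1%:M; ZI; IZ; ZZ] t.

Lemma sum_noise_weight p (F : 'I_4 -> 'M[R[i]]_(2 ^ 2)) :
  \sum_t (noise_weight p t)%:C *: F t = (1 - p)%:C *: F ord0 +
  (p / 3)%:C *: (F (lift ord0 ord0) + F (lift ord0 (lift ord0 ord0)) +
                 F (lift ord0 (lift ord0 (lift ord0 ord0)))).
Proof. by rewrite !big_ord_recl big_ord0 addr0 !scalerDr !addrA. Qed.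

Lemma noise_weight_prob p : 0 <= p -> p <= 1 -> prob_weights (noise_weight p).
Proof.
move=> p0 p1; split=> [t|].
  by rewrite /noise_weight; case: ifP => _; rewrite ?subr_ge0 // divr_ge0.
by rewrite !big_ord_recl big_ord0 /noise_weight /=; field.
Qed.

Lemma noise_kraus_gaussian t : gaussian (noise_kraus t).
Proof.
case: t => -[|[|[|[|//]]]] ?.
- exact: gaussian1.
- exact: gaussian_ZI.
- exact: gaussian_IZ.
- exact: gaussian_ZZ.
Qed.

Lemma noiseE p rho :
  noise p rho = \sum_t (noise_weight p t)%:C *: unitary_channel (noise_kraus t) rho.
Proof.
rewrite sum_noise_weight /noise_kraus /=.
rewrite /unitary_channel ZI_adj IZ_adj ZZ_adj trmx1 map_mx1 mul1mx mulmx1.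
rewrite /noise /dephase1 /dephase2 -/ZI -/IZ; congr (_ + _ *: (_ + _)).
by rewrite -ZI_IZ {2}ZI_IZ_comm !mulmxA.
Qed.

Definition noisy_RZZ theta p := noise p \o unitary_channel (RZZ theta).

Lemma noisy_RZZ_convex_gaussian theta p : 0 <= p -> p <= 1 ->
  convex_gaussian_channel (n := 2) (noisy_RZZ theta p).
Proof.
move=> p0 p1.
have -> : noisy_RZZ theta p = fun rho => \sum_t (noise_weight p t)%:C *:
    unitary_channel (noise_kraus t *m RZZ theta) rho.
  apply/funext => rho; rewrite /noisy_RZZ /= noiseE.
  by apply: eq_bigr => t _; rewrite unitary_channel_mul.
apply: convex_gaussian_mixture => [|t|t _ [V GV ->]].
- exact: noise_weight_prob.
- by apply: mul_unitarymx (RZZ_unitary theta); case: (noise_kraus_gaussian t).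
(* [RZZ] fixes the projector onto a state of definite parity, so only the Gaussian error operator
   changes the state. *)
- exists (noise_kraus t *m (V *m ket0 R 2)).
    exists (noise_kraus t *m V); last by rewrite mulmxA.
    exact: gaussian_mul (noise_kraus_gaussian t) GV.
  have [l l2 lV] := gaussian_parity GV.
  rewrite unitary_channel_mul (RZZ_eigen theta l2 lV).
  by rewrite /unitary_channel !trmx_mul !map_mxM !mulmxA.
Qed.

(** The middle entries omit [RZZ]: the two single-qubit errors have equal weight, so only the sum of
    their channels matters. *)
Definition RZZ_kraus theta (t : 'I_4) : 'M[R[i]]_(2 ^ 2) :=
  nth 1%:M [:: RZZ theta; ZI; IZ; ZZ *m RZZ theta] t.

Lemma noisy_RZZE theta p rho :
  noisy_RZZ theta p rho =
  \sum_t (noise_weight p t)%:C *: unitary_channel (RZZ_kraus theta t) rho.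
Proof.
rewrite [LHS]noiseE !sum_noise_weight /noise_kraus /RZZ_kraus /=.
congr (_ + _ *: (_ + _)).
- by rewrite {1}/unitary_channel trmx1 map_mx1 mul1mx mulmx1.
(* Since [IZ] is [ZI *m ZZ], both single-qubit terms factor through the channel of [ZI], leaving
   inside it the sum treated by [RZZ_channel_parity]. *)
- have IZE A : unitary_channel IZ A = unitary_channel ZI (unitary_channel ZZ A).
    by rewrite -unitary_channel_mul -ZI_IZ mulmxA ZI_sqr mul1mx.
  rewrite (IZE rho) (IZE (unitary_channel _ _)).
  rewrite -(unitary_channelD ZI rho) -(RZZ_channel_parity theta).
  by rewrite unitary_channelD (unitary_channel_mul ZZ).
- by rewrite (unitary_channel_mul ZZ).
Qed.

Lemma RZZ_kraus_unitary theta t : RZZ_kraus theta t \is unitarymx.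
Proof.
case: t => -[|[|[|[|//]]]] ?.
- exact: RZZ_unitary.
- by case: (gaussian_ZI R).
- by case: (gaussian_IZ R).
- by apply: mul_unitarymx (RZZ_unitary theta); case: (gaussian_ZZ R).
Qed.

Lemma RZZ_kraus_extent theta p : 0 <= p -> p <= 1 ->
  (\sum_t (noise_weight p t)%:E * unitary_extent (n := 2) (RZZ_kraus theta t) <=
   (1 + (1 - 2 / 3 * p) * `|sin theta|)%:E)%E.
Proof.
move=> p0 p1; have [w0 _] := noise_weight_prob p0 p1.
(* Only the outer two terms cost more than 1; their weights [1 - p] and [p / 3] add up to
   [1 - 2 / 3 * p]. *)
pose b (t : 'I_4) : R := nth 1 [:: 1 + `|sin theta|; 1; 1; 1 + `|sin theta|] t.
have -> : 1 + (1 - 2 / 3 * p) * `|sin theta| = \sum_t noise_weight p t * b t.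
  by rewrite !big_ord_recl big_ord0 /noise_weight /b /=; field.
rewrite -sumEFin; apply: lee_sum => t _; rewrite EFinM.
apply: lee_wpmul2l; first by rewrite lee_fin.
case: t => -[|[|[|[|//]]]] ?.
- exact: unitary_extent_RZZ.
- exact: unitary_extent_gaussian (gaussian_ZI R).
- exact: unitary_extent_gaussian (gaussian_IZ R).
- exact: unitary_extent_ZZ_RZZ.
Qed.

Lemma augmented_extent_convex_gaussian n (Phi : 'M[R[i]]_(2 ^ n) -> 'M[R[i]]_(2 ^ n)) :
  convex_gaussian_channel Phi -> (augmented_channel_extent Phi <= 1%:E)%E.
Proof.
move=> PhiG; apply: ereal_inf_lbound.
(* No unitary term, and [Phi] itself as the single convex-Gaussian term of weight 1. *)
exists 0%N, 1%N, (fun=> 0), (fun=> 1), (fun=> 1%:M), (fun=> Phi); split.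
- by split=> //; rewrite big_ord0 add0r big_ord1.
- by case.
- by [].
- by move=> rho; rewrite big_ord0 add0r big_ord1 scale1r.
- by rewrite big_ord0 add0e big_ord1.
Qed.

End Extent.

(** The second bound is restricted because for [p > 1 / 2] and [sin theta] nonzero its right side is
    below 1. Every decomposition costs at least its total weight 1: a unitary has operator norm 1,
    hence extent at least 1. *)
Theorem mainTheorem11 (R : realType) (theta p : R)
    (hp0 : 0 <= p) (hp1 : p <= 1) :
  let N' := noise p \o unitary_channel (RZZ theta) in
  (channel_extent (n := 2) N'
     <= (1 + (1 - 2 / 3 * p) * `|sin theta|)%:E)%E /\
  (p <= 1 / 2 \/ sin theta = 0 ->
   (augmented_channel_extent (n := 2) N'
      <= (1 + (1 - 2 * p) * `|sin theta|)%:E)%E).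
Proof.
move=> N'; split=> [|ps].
  apply: le_trans (RZZ_kraus_extent theta hp0 hp1); apply: ereal_inf_lbound.
  exists 4%N, (noise_weight p), (@RZZ_kraus R theta); split=> //.
  - exact: noise_weight_prob.
  - exact: RZZ_kraus_unitary.
  - exact: noisy_RZZE.
have N'G := noisy_RZZ_convex_gaussian theta hp0 hp1.
(* The extent is already at most 1, so it remains to see that the added term is nonnegative. *)
apply: le_trans (augmented_extent_convex_gaussian N'G) _.
rewrite lee_fin lerDl; case: ps => [p2|->]; last by rewrite normr0 mulr0.
by apply: mulr_ge0 => //; lra.
Qed.
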